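(* For every nonnegative integer $n$, $$pod(n)=\sum_{\substack{j\ge 0\\ j \text{ even}}}(-1)^{j/2}\,pod\!\left(\frac{j}{2}\right)ped(n-j).$$
   Context: $pod(n)$ denotes the number of partitions of the nonnegative integer $n$ in which odd parts are distinct and even parts may be repeated, with $pod(0)=1$. $ped(n)$ denotes the number of partitions of $n$ in which even parts are distinct and odd parts may be repeated, with $ped(0)=1$ and $ped(m)=0$ for $m<0$. *)

(* Defs.v *)
From mathcomp Require Import all_boot all_algebra.

Set Implicit Arguments.
Unset Strict Implicit.
Unset Printing Implicit Defensive.

Definition is_partition (n : nat) (s : seq nat) : bool :=
  [&& sorted geq s, all (fun x => 0 < x) s & sumn s == n].

(* A partition of n has at most n parts, each at most n, hence is an element
   of the finite type n.-bseq 'I_n.+1; see is_partition_bseq below. *)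
Definition parts (n : nat) (b : n.-bseq 'I_n.+1) : seq nat :=
  [seq nat_of_ord i | i <- b].

Definition num_partitions (P : pred (seq nat)) (n : nat) : nat :=
  #|[set b : n.-bseq 'I_n.+1 | is_partition n (parts b) && P (parts b)]|.

Definition odd_parts_distinct (s : seq nat) : bool :=
  uniq [seq x <- s | odd x].

Definition even_parts_distinct (s : seq nat) : bool :=
  uniq [seq x <- s | ~~ odd x].

Definition pod (n : nat) : nat := num_partitions odd_parts_distinct n.

Definition ped (m : int) : nat :=
  match m with
  | Posz n => num_partitions even_parts_distinct n
  | Negz _ => 0
  end.

Lemma parts_inj n : injective (@parts n).
Proof. by move=> a b /(inj_map val_inj) /val_inj. Qed.

Lemma is_partition_bseq n s :
  is_partition n s -> exists b : n.-bseq 'I_n.+1, parts b = s.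
Proof.
case/and3P=> _ s_gt0 /eqP sum_s.
have size_s : size s <= n.
  rewrite -sum_s; elim: s s_gt0 {sum_s} => //= x s IHs /andP[x_gt0 /IHs].
  by rewrite -add1n; apply: leq_add.
have le_s x : x \in s -> x <= n.
  rewrite -sum_s; elim: s {s_gt0 sum_s size_s} => //= y s IHs.
  rewrite inE => /predU1P[-> | /IHs le_x]; first exact: leq_addr.
  exact: leq_trans le_x (leq_addl _ _).
have size_t : size [seq inord x : 'I_n.+1 | x <- s] <= n by rewrite size_map.
exists (Bseq size_t); rewrite /parts /= -map_comp -[RHS]map_id.
by apply/eq_in_map => x /le_s le_x /=; rewrite inordK.
Qed.

(* Main.v *)
Require Import Defs.
From mathcomp Require Import all_boot all_algebra.
From mathcomp Require Import ring.
From mathcomp Require Import boolp classical_sets fsbigop.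
Local Open Scope classical_set_scope.
Local Open Scope ring_scope.

Set Implicit Arguments.
Unset Strict Implicit.

Import GRing.Theory.

(** Expanding the infinite products as generating functions,
    POD(q) = prod (1 + q^(2i-1)) / (1 - q^(2i)) and
    PED(q) = prod (1 + q^(2i)) / (1 - q^(2i-1)).
    Since 1 - q^(2k) = (1 - q^k) (1 + q^k), replacing q by -q^2 gives
    POD(-q^2) = prod (1 - q^(2i-1)) (1 + q^(2i-1)) / ((1 - q^(2i)) (1 + q^(2i))),
    hence POD(q) = POD(-q^2) PED(q).  To find the coefficient of q^n it is
    enough to use parts of size at most n and to compute modulo q^(n+1). *)

(** Turns distinctness into a bound on multiplicities, which is the form the factors of the
    generating function can express. *)
Lemma uniq_filterP (d : pred nat) (s : seq nat) :
  reflect (forall x, d x -> (count_mem x s <= 1)%N) (uniq [seq x <- s | d x]).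
Proof.
have cE x : d x -> count_mem x [seq x <- s | d x] = count_mem x s.
  by move=> dx; rewrite count_filter; apply: eq_count => y /=; case: eqP => // ->.
apply: (iffP idP) => [us x dx|cs].
  by rewrite -cE // count_uniq_mem // leq_b1.
apply/count_mem_uniq => x; have [dx|ndx] := boolP (d x).
  have := cs x dx; rewrite -cE // -has_pred1 has_count.
  by case: (count_mem x _) => [|[]].
by rewrite mem_filter (negPf ndx); apply/count_memPn; rewrite mem_filter (negPf ndx).
Qed.

Lemma sumn_count_mem (n : nat) (s : seq nat) :
  all (fun x => 0 < x <= n)%N s ->
  sumn s = (\sum_(i < n) i.+1 * count_mem i.+1 s)%N.
Proof.
elim: s => [_|[//|x] s IHs /= /andP[lt_xn /IHs ->]].
  by rewrite big1 // => i _; rewrite muln0.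
under [RHS]eq_bigr do rewrite mulnDr.
rewrite [RHS]big_split; congr (_ + _)%N.
rewrite (bigD1 (Ordinal lt_xn)) //= eqxx muln1 big1 ?addn0 // => i neq_ix.
by rewrite eqSS eq_sym (negPf (neq_ix : (i : nat) != x)) muln0.
Qed.

(* Takes partitions of every m <= n to one finite type that depends on n only;
   [i : 'I_n] stands for the part [i.+1]. *)
Definition multiplicities m n (b : m.-bseq 'I_m.+1) : {ffun 'I_n -> 'I_n.+1} :=
  [ffun i : 'I_n => inord (count_mem i.+1 (parts b))].

Lemma multiplicitiesE m n (b : m.-bseq 'I_m.+1) (i : 'I_n) :
  (m <= n)%N -> multiplicities n b i = count_mem i.+1 (parts b) :> nat.
Proof.
move=> le_mn; rewrite ffunE inordK // ltnS (leq_trans (count_size _ _)) //.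
by rewrite size_map (leq_trans (size_bseq b)).
Qed.

Lemma partition_parts_bound m n (b : m.-bseq 'I_m.+1) : (m <= n)%N ->
  is_partition m (parts b) -> all (fun x => 0 < x <= n)%N (parts b).
Proof.
move=> le_mn /and3P[_ /allP b_gt0 _]; apply/allP => x xb.
by rewrite b_gt0 //=; case/mapP: xb => i _ ->; rewrite (leq_trans _ le_mn) // -ltnS.
Qed.

(** All parts lie between 1 and [n], so equal multiplicities make the two sequences permutations of
    each other; both are sorted, hence equal. *)
Lemma multiplicities_inj m n (b c : m.-bseq 'I_m.+1) : (m <= n)%N ->
  is_partition m (parts b) -> is_partition m (parts c) ->
  multiplicities n b = multiplicities n c -> b = c.
Proof.
move=> le_mn pb pc eq_bc; apply: parts_inj.
have geq_trans : transitive geq by move=> x y z /= xy yz; apply: leq_trans yz xy.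
have geq_anti : antisymmetric geq by move=> x y; rewrite /= andbC; apply: anti_leq.
have [sb _ _] := and3P pb; have [sc _ _] := and3P pc.
apply: (sorted_eq geq_trans geq_anti) => //; apply/allP => x.
rewrite mem_cat => xbc; apply/eqP.
have : (0 < x <= n)%N.
  have /allP hb := partition_parts_bound le_mn pb.
  have /allP hc := partition_parts_bound le_mn pc.
  by case/orP: xbc => [/hb|/hc].
case: x {xbc} => //= x lt_xn.
have /(congr1 val) := congr1 (fun f : {ffun _} => f (Ordinal lt_xn)) eq_bc.
by rewrite /= !multiplicitiesE.
Qed.

(** Surjectivity of the passage to multiplicities: concatenate [f i] copies of each [i.+1], then
    sort. *)
Lemma partition_with_multiplicities n (f : {ffun 'I_n -> 'I_n.+1}) :
  exists2 s : seq nat,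
    is_partition (\sum_(i < n) i.+1 * f i)%N s &
    forall i : 'I_n, count_mem i.+1 s = f i.
Proof.
pose t := flatten [seq nseq (f i) i.+1 | i <- enum 'I_n].
have ct (i : 'I_n) : count_mem i.+1 t = f i.
  rewrite count_flatten -map_comp sumnE big_map big_enum /= (bigD1 i) //=.
  rewrite count_nseq /= eqxx mul1n big1 ?addn0 // => j neq_ji.
  by rewrite count_nseq /= eqSS (negPf (neq_ji : (j : nat) != i)).
have bt : all (fun x => 0 < x <= n)%N t.
  by apply/allP => x /flattenP[_ /mapP[i _ ->] /nseqP[-> _]] /=.
exists (sort geq t) => [|i]; last by rewrite -ct; apply/permP/permEl/perm_sort.
apply/and3P; split.
- by apply: sort_sorted => x y; apply: leq_total.
- by rewrite all_sort; apply: sub_all bt => x; case/andP.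
- rewrite sumnE (perm_big t) ?perm_sort //= -sumnE (sumn_count_mem bt) //.
  by apply/eqP/eq_bigr => i _; rewrite ct.
Qed.

(** Truncated generating function: [k] is the multiplicity of the part [i.+1], and [d] marks the
    sizes that may not repeat. Bounding [k] by [n] loses nothing up to degree [n]. *)
Definition partition_poly (d : pred nat) (n : nat) : {poly int} :=
  \prod_(i < n) \sum_(k < n.+1 | d i.+1 ==> (k <= 1)%N) 'X^(i.+1 * k).

(** Distributing the product over the sums gives one monomial per choice [f] of multiplicities;
    those of degree [m] correspond to the partitions of [m]. *)
Lemma coef_partition_poly d n m : (m <= n)%N ->
  (partition_poly d n)`_m =
  (num_partitions (fun s => uniq [seq x <- s | d x]) m)%:Z.
Proof.
move=> le_mn; rewrite /partition_poly bigA_distr_big_dep coef_sum.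
under eq_bigr => f _ do rewrite prodrXr coefXn mulrb.
rewrite -big_mkcondr sumr_const natz; congr Posz.
rewrite /num_partitions; set B := finset _.
have inj : {in B &, injective (@multiplicities m n)}.
  move=> b c; rewrite !inE => /andP[pb _] /andP[pc _].
  exact: multiplicities_inj.
rewrite -(card_in_imset inj); apply: eq_card => f.
rewrite unfold_in; apply/andP/imsetP.
- case=> /familyP fd /eqP sum_f.
  have [s ps cs] := partition_with_multiplicities f; rewrite -sum_f in ps.
  have [b bE] := is_partition_bseq ps; exists b.
    rewrite inE bE ps; apply/uniq_filterP => x dx.
    have [xs|/count_memPn -> //] := boolP (x \in s).
    have pb : is_partition m (parts b) by rewrite bE.
    have /allP := partition_parts_bound le_mn pb; rewrite bE => /(_ x xs).
    case: x dx {xs} => //= x dx lt_xn.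
    by have := fd (Ordinal lt_xn); rewrite unfold_in dx -cs.
  by apply/ffunP => i; apply: val_inj; rewrite /= multiplicitiesE // bE cs.
- case=> b; rewrite inE => /andP[pb /uniq_filterP db] ->; split.
    apply/familyP => i; rewrite unfold_in multiplicitiesE //.
    by apply/implyP => /db.
  have /and3P[_ _ /eqP {1}<-] := pb.
  rewrite (sumn_count_mem (partition_parts_bound le_mn pb)).
  by apply/eqP/eq_bigr => i _; rewrite multiplicitiesE.
Qed.

(* Explicit cofactors, unlike equality of the first N coefficients, are preserved
   by composition without any computation of coefficients. *)
Definition eqmodX (R : comNzRingType) (N : nat) (p q : {poly R}) : Prop :=
  exists r, p = q + r * 'X^N.

Lemma eqmodX_coef (R : comNzRingType) N (p q : {poly R}) i :
  eqmodX N p q -> (i < N)%N -> p`_i = q`_i.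
Proof. by case=> r -> lt_iN; rewrite coefD coefMXn lt_iN addr0. Qed.

Lemma eqmodX_refl (R : comNzRingType) N (p : {poly R}) : eqmodX N p p.
Proof. by exists 0; rewrite mul0r addr0. Qed.

Lemma eqmodXM (R : comNzRingType) N (p1 p2 q1 q2 : {poly R}) :
  eqmodX N p1 q1 -> eqmodX N p2 q2 -> eqmodX N (p1 * p2) (q1 * q2).
Proof.
move=> [r1 ->] [r2 ->]; exists (r1 * q2 + q1 * r2 + r1 * r2 * 'X^N).
by ring.
Qed.

Lemma eqmodX_prod (R : comNzRingType) N (I : finType) (p q : I -> {poly R}) :
  (forall i, eqmodX N (p i) (q i)) -> eqmodX N (\prod_i p i) (\prod_i q i).
Proof.
by move=> epq; apply: big_ind2 => //; [apply: eqmodX_refl | move=> *; apply: eqmodXM].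
Qed.

Lemma eqmodX_comp_NX2 (R : comNzRingType) N (p q : {poly R}) :
  eqmodX N p q -> eqmodX N (p \Po - 'X^2) (q \Po - 'X^2).
Proof.
case=> r ->; exists ((r \Po - 'X^2) * ((-1) ^+ N * 'X^N)).
rewrite comp_polyD comp_polyM comp_Xn_poly -!mulrA -exprD addnn -mul2n.
by rewrite (exprNn 'X^2) -exprM.
Qed.

(** Induction on [N]: if [p - q = s * 'X^N], cancelling ['X^N] leaves [s * e = r * 'X]. The constant
    coefficient of [s] is then 0, so ['X] divides [s]. *)
Lemma eqmodX_cancel (R : idomainType) N (e p q : {poly R}) :
  e`_0 = 1 -> eqmodX N (p * e) (q * e) -> eqmodX N p q.
Proof.
move=> e0 [r re].
suff [s sE] : exists s, p - q = s * 'X^N by exists s; rewrite -sE addrC subrK.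
have {re} : (p - q) * e = r * 'X^N by rewrite mulrBl re addrC addKr.
elim: N r => [|N IHN] r; first by exists (p - q); rewrite mulr1.
rewrite exprS mulrA => /[dup] /IHN [s ->].
rewrite mulrAC => /(mulIf (monic_neq0 (monicXn _ N))) /(congr1 (coefp 0)).
rewrite /= coefM big_ord1 e0 mulr1 coefMX /= => s0.
have /factor_theorem[t ->] : root s 0 by rewrite rootE horner_coef0 s0.
by exists t; rewrite subr0 mulrA.
Qed.

Lemma partition_poly_mul d n :
  eqmodX n.+1 (partition_poly d n * \prod_(i < n | ~~ d i.+1) (1 - 'X^(i.+1)))
              (\prod_(i < n | d i.+1) (1 + 'X^(i.+1))).
Proof.
rewrite (big_mkcond (fun i : 'I_n => ~~ _)) (big_mkcond (fun i : 'I_n => d _)).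
rewrite -big_split /=.
apply: eqmodX_prod => i; case: (d i.+1) => /=.
  (* The index [i] forces [n] to be positive, so both [k = 0] and [k = 1] are in range. *)
  rewrite mulr1; case: n i => [[]//|n i].
  rewrite big_mkcond 2!big_ord_recl big1 /=; last by case.
  by rewrite muln0 muln1 addr0; apply: eqmodX_refl.
under eq_bigr do rewrite exprM.
(* The geometric sum times [1 - 'X^(i.+1)] is [1 - 'X^(i.+1 * n.+1)]. *)
exists (- 'X^(i * n.+1)).
by rewrite mulrC -opprB mulNr -subrX1 opprB mulNr -exprD -exprM mulSn addnC.
Qed.

Lemma partition_poly_pod_ped n :
  let P := partition_poly odd n in
  let Q := partition_poly (fun i => ~~ odd i) n in
  eqmodX n.+1 P ((P \Po - 'X^2) * Q).
Proof.
move=> P Q.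
pose Ap : {poly int} := \prod_(i < n | odd i.+1) (1 + 'X^(i.+1)).
pose Am : {poly int} := \prod_(i < n | odd i.+1) (1 - 'X^(i.+1)).
pose Bp : {poly int} := \prod_(i < n | ~~ odd i.+1) (1 + 'X^(i.+1)).
pose Bm : {poly int} := \prod_(i < n | ~~ odd i.+1) (1 - 'X^(i.+1)).
have hP : eqmodX n.+1 (P * Bm) Ap by exact: partition_poly_mul.
have [r2 hQ] : eqmodX n.+1 (Q * Am) Bp.
  rewrite /Am (eq_bigl (fun i : 'I_n => ~~ ~~ odd i.+1)); last first.
    by move=> i; rewrite negbK.
  exact: partition_poly_mul.
(* The substitution sends ['X^k] to [(-1)^k 'X^(2k)]: the sign flips for odd [k] and stays for even
   [k], so each factor becomes [1 - 'X^(2k)] in both products. *)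
have ApE : Ap \Po - 'X^2 = Am * Ap.
  rewrite rmorph_prod -big_split; apply: eq_bigr => i oi.
  rewrite /= comp_polyD comp_polyC comp_Xn_poly (exprNn 'X^2) -signr_odd oi.
  by rewrite -exprM mul2n -addnn exprD; ring.
have BmE : Bm \Po - 'X^2 = Bm * Bp.
  rewrite rmorph_prod -big_split; apply: eq_bigr => i /negPf oi.
  rewrite /= comp_polyB comp_polyC comp_Xn_poly (exprNn 'X^2) -signr_odd oi.
  by rewrite -exprM mul2n -addnn exprD; ring.
have [r3] := eqmodX_comp_NX2 hP; rewrite comp_polyM ApE BmE => hPX.
have {hP}[r1 hP] := hP.
(* This multiplier clears all denominators: both sides become [Am * Ap * Bp] modulo ['X^(n.+1)]. *)
apply: (@eqmodX_cancel _ _ (Am * (Bm * Bp))).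
  rewrite -horner_coef0 !hornerM !horner_prod.
  by rewrite !big1 ?mulr1 // => i _; rewrite !hornerE exprS mul0r ?subr0 ?addr0.
pose T : {poly int} := 'X^(n.+1).
(* The error of [(Ap + r1 * T) * (Am * Bp)] minus that of [(Am * Ap + r3 * T) * (Bp + r2 * T)],
   divided by [T]. *)
exists (r1 * (Am * Bp) - Am * Ap * r2 - r3 * Bp - r3 * r2 * T).
transitivity ((P * Bm) * (Am * Bp)); first by ring.
transitivity (((P \Po - 'X^2) * (Bm * Bp)) * (Q * Am)
  + (r1 * (Am * Bp) - Am * Ap * r2 - r3 * Bp - r3 * r2 * T) * T);
  last by rewrite /T; ring.
by rewrite hP hQ hPX -/T; ring.
Qed.

Lemma coef_comp_NX2 (R : comNzRingType) (p : {poly R}) m :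
  (p \Po - 'X^2)`_m = if odd m then 0 else (-1) ^+ m./2 * p`_m./2.
Proof.
(* Separates the sign change from the dilation of exponents. *)
have -> : - 'X^2 = (-1)%:P * 'X \Po 'X^2 :> {poly R}.
  by rewrite comp_polyM comp_polyC comp_polyX polyCN mulN1r.
rewrite comp_polyA coef_comp_poly_Xn // dvdn2 divn2; case: (odd m) => //=.
rewrite comp_polyE.
under eq_bigr do rewrite exprMn -polyC_exp mul_polyC scalerA.
rewrite -(poly_def (size p) (fun i => p`_i * (-1) ^+ i)) coef_poly mulrC.
by case: ltnP => // le_pm; rewrite [X in _ * X]nth_default ?mulr0.
Qed.

Theorem theorem4p1 (n : nat) :
  (pod n)%:Z =
  \sum_(j \in [set j : nat | ~~ odd j])
    (-1) ^+ j./2 * (pod j./2)%:Z * (ped (n%:Z - j%:Z))%:Z.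
Proof.
have podE m : (m <= n)%N -> (partition_poly odd n)`_m = (pod m)%:Z.
  by move=> ?; apply: coef_partition_poly.
rewrite -podE // (eqmodX_coef (partition_poly_pod_ped n)) // coefM.
(* The sum over all even [j] has its support in [j <= n]. *)
rewrite (@fsbigE _ _ _ _ _ [seq j <- index_iota 0 n.+1 | ~~ odd j]).
- rewrite big_filter_cond -(big_mkord xpredT (fun j =>
    (partition_poly odd n \Po - 'X^2)`_j * (partition_poly _ n)`_(n - j))).
  rewrite [LHS]big_mkcond [RHS]big_mkcond; apply: eq_big_nat => j /andP[_ lt_jn].
  rewrite coef_comp_NX2 mem_setE unfold_in /= andbb.
  case: (odd j) => /=; first by rewrite mul0r.
  rewrite podE; last by rewrite -divn2 (leq_trans (leq_div _ _)).
  by rewrite coef_partition_poly ?leq_subr // subzn.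
- by rewrite filter_uniq // iota_uniq.
- move=> j jr; suff : j \in [seq j <- index_iota 0 n.+1 | ~~ odd j].
    by rewrite mem_filter => /andP[].
  exact: jr.
(* For [j > n] the argument of [ped] is negative, so the term vanishes. *)
- move=> j oj; rewrite mem_filter [~~ odd j]oj mem_index_iota ltnS -ltnNge => lt_nj.
  by rewrite -(subnKC lt_nj) addSn -addnS PoszD opprD addrA subrr sub0r mulr0.
Qed.
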